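(* Let $\mathcal{L}(x,y)=f(x)+\langle Kx,y\rangle-h^\ast(y)$ with $f=\sum_{i=1}^N f_i$ be as in the context, and assume: (A1) each $f_i$ ($1\le i\le N$) is $L_i$-smooth, with $L:=\sum_{i=1}^N L_i>0$; (A2) $h^\ast:\mathbb{R}^{d_2}\to(-\infty,\infty]$ is proper, closed and convex; (A3) the delays satisfy $\tau_k^i\in\{0,1,\dots,T\}$ for all $k$ and $i$, for a fixed nonnegative integer $T$. Assume $\mathcal{L}$ has a saddle point $(\hat x,\hat y)$. Let $\{(x_k,y_k)\}_{k\ge 0}$ be generated by the PD-PIAG iteration with $\bar y=2y_k-y_{k-1}$ at iteration $k$, i.e. $$g_k=\sum_{i=1}^N\nabla f_i(x_{k-\tau_k^i}),\quad x_{k+1}=x_k-\sigma g_k-\sigma K^T(2y_k-y_{k-1}),\quad y_{k+1}=\mathrm{Prox}_{\tau h^\ast}(y_k+\tau Kx_{k+1}),$$ where the step sizes $\sigma,\tau>0$ satisfy $$\sqrt{\tau\sigma}\,\|K\|+\sigma L(T+1)^2<1.$$ Then: (i) The sequence $\{(x_k,y_k)\}$ is bounded; precisely, for all $k\ge 0$, $$\frac{\|x_k-\hat x\|^2}{2\sigma}+\frac{\|y_k-\hat y\|^2}{2\tau}\le C\left(\frac{\|x_0-\hat x\|^2}{2\sigma}+\frac{\|y_0-\hat y\|^2}{2\tau}\right),\qquad C=(1-\tau\sigma\|K\|^2)^{-1}.$$ (ii) Let $\bar x_M=\frac1M\sum_{k=1}^M x_k$ and $\bar y_M=\frac1M\sum_{k=1}^M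 y_k$ for all integers $M>0$. Then for any bounded closed set $B_1\times B_2\subset\mathbb{R}^{d_1}\times\mathbb{R}^{d_2}$, $$\mathcal{G}_{B_1\times B_2}(\bar x_M,\bar y_M)\le\frac1M\max_{(x,y)\in B_1\times B_2}\left\{\frac{\|x-x_0\|^2}{2\sigma}+\frac{\|y-y_0\|^2}{2\tau}\right\}.$$ Moreover, the cluster points of $\{(\bar x_M,\bar y_M)\}$ are saddle points of $\mathcal{L}$. (iii) There exists a saddle point $(x^\ast,y^\ast)$ of $\mathcal{L}$ such that $x_k\to x^\ast$ and $y_k\to y^\ast$.
   Context: Setting: $f_1,\dots,f_N:\mathbb{R}^{d_1}\to\mathbb{R}$ are smooth (differentiable) convex functions, $f=\sum_{i=1}^N f_i$, $K\in\mathbb{R}^{d_2\times d_1}$ is a matrix, $h^\ast$ is a convex, possibly nonsmooth function on $\mathbb{R}^{d_2}$ (in the application, the conjugate of a convex function $h$), and $\mathcal{L}(x,y):=f(x)+\langle Kx,y\rangle-h^\ast(y)$. $\|\cdot\|$ is the Euclidean norm for vectors and the induced operator norm for $K$. $f_i$ is $L_i$-smooth if $|f_i(y)-f_i(x)-\langle\nabla f_i(x),y-x\rangle|\le\frac{L_i}{2}\|y-x\|^2$ for all $x,y$. A point $(\hat x,\hat y)$ is a saddle point of $\mathcal{L}$ if $\mathcal{L}(\hat x,y)\le\mathcal{L}(\hat x,\hat y)\le\mathcal{L}(x,\hat y)$ for all $(x,y)\in\mathbb{R}^{d_1}\times\mathbb{R}^{d_2}$. Partial primal-dual gap: for closed sets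 $B_1\subset\mathbb{R}^{d_1}$, $B_2\subset\mathbb{R}^{d_2}$ (nonempty), $\mathcal{G}_{B_1\times B_2}(x,y):=\max_{y'\in B_2}\mathcal{L}(x,y')-\min_{x'\in B_1}\mathcal{L}(x',y)$. Proximal operator: $\mathrm{Prox}_G(z):=\arg\min_u\{G(u)+\frac12\|u-z\|^2\}$. Delays $\tau_k^i$ ($k\ge 0$, $1\le i\le N$) are integers (not to be confused with the step size $\tau$). The initial point $(x_0,y_0)\in\mathbb{R}^{d_1}\times\mathbb{R}^{d_2}$ is arbitrary, and by convention $x_j=x_0$ and $y_j=y_0$ for $j<0$. *)

(* Defs.v *)
From HB Require Import structures.
From mathcomp Require Import all_boot all_order all_algebra.
From mathcomp Require Import all_classical all_reals all_analysis.
Import Order.TTheory GRing.Theory Num.Theory.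
Import numFieldNormedType.Exports.

Set Implicit Arguments.
Unset Strict Implicit.
Unset Printing Implicit Defensive.

Local Open Scope classical_set_scope.
Local Open Scope ring_scope.

(* R^d is 'cV[R]_d. The norm that MathComp-Analysis puts on matrices is the
   max norm: it gives the usual topology, bounded sets and differentiability,
   but the quantitative statements need the Euclidean norm [enorm]. *)
Definition dotp (R : realType) (d : nat) (u v : 'cV[R]_d) : R :=
  \sum_(i < d) u i 0 * v i 0.

Definition enorm (R : realType) (d : nat) (u : 'cV[R]_d) : R :=
  Num.sqrt (dotp u u).

Definition opnorm (R : realType) (m n : nat) (K : 'M[R]_(m, n)) : R :=
  sup [set enorm (K *m x) | x in [set x : 'cV[R]_n | enorm x <= 1]].

(* Vector of partial derivatives; it is the gradient where [f] is
   differentiable. *)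
Definition grad (R : realType) (d : nat) (f : 'cV[R]_d -> R) (x : 'cV[R]_d) :
  'cV[R]_d := \col_i 'D_(delta_mx i 0) f x.

Definition Lsmooth (R : realType) (d : nat) (L : R) (f : 'cV[R]_d -> R) : Prop :=
  forall x y : 'cV[R]_d,
    `|f y - f x - dotp (grad f x) (y - x)| <= L / 2 * enorm (y - x) ^+ 2.

Definition proper_efun (R : realType) (d : nat) (h : 'cV[R]_d -> \bar R) : Prop :=
  (forall y, h y != -oo%E) /\ (exists y, h y != +oo%E).

Definition epigraph (R : realType) (d : nat) (h : 'cV[R]_d -> \bar R) :
  set ('cV[R]_d * R) := [set p | (h p.1 <= p.2%:E)%E].

Definition closed_efun (R : realType) (d : nat) (h : 'cV[R]_d -> \bar R) : Prop :=
  closed (epigraph h).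

(* Meant for functions that never take the value -oo; the endpoints t = 0, 1
   rely on 0 * +oo = 0. *)
Definition convex_efun (R : realType) (d : nat) (h : 'cV[R]_d -> \bar R) : Prop :=
  forall (t : R) (u v : 'cV[R]_d), 0 <= t <= 1 ->
    (h (t *: u + (1 - t) *: v)%R <= t%:E * h u + (1 - t)%:E * h v)%E.

Definition lagrangian (R : realType) (d1 d2 : nat) (f : 'cV[R]_d1 -> R)
    (K : 'M[R]_(d2, d1)) (hs : 'cV[R]_d2 -> \bar R)
    (x : 'cV[R]_d1) (y : 'cV[R]_d2) : \bar R :=
  ((f x + dotp (K *m x) y)%:E - hs y)%E.

Definition saddle_point (R : realType) (d1 d2 : nat)
    (Lag : 'cV[R]_d1 -> 'cV[R]_d2 -> \bar R)
    (xh : 'cV[R]_d1) (yh : 'cV[R]_d2) : Prop :=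
  forall (x : 'cV[R]_d1) (y : 'cV[R]_d2),
    (Lag xh y <= Lag xh yh)%E /\ (Lag xh yh <= Lag x yh)%E.

(* Supremum and infimum stand for max and min: they are always defined in
   \bar R, and agree with max and min whenever the latter exist. *)
Definition pd_gap (R : realType) (d1 d2 : nat)
    (Lag : 'cV[R]_d1 -> 'cV[R]_d2 -> \bar R)
    (B1 : set 'cV[R]_d1) (B2 : set 'cV[R]_d2)
    (x : 'cV[R]_d1) (y : 'cV[R]_d2) : \bar R :=
  (ereal_sup [set Lag x y' | y' in B2] - ereal_inf [set Lag x' y | x' in B1])%E.

(* Set of minimizers; a singleton when [G] is proper, closed and convex. *)
Definition prox (R : realType) (d : nat) (G : 'cV[R]_d -> \bar R)
    (z : 'cV[R]_d) : set 'cV[R]_d :=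
  [set u | forall v : 'cV[R]_d,
    (G u + (2^-1 * enorm (u - z) ^+ 2)%:E <=
     G v + (2^-1 * enorm (v - z) ^+ 2)%:E)%E].

(* The subtraction [k - delay k i] and the predecessor [k.-1] are truncated at
   0, which implements the conventions x_j = x_0 and y_j = y_0 for j < 0. *)
Definition pd_piag (R : realType) (d1 d2 N : nat)
    (f : 'I_N -> 'cV[R]_d1 -> R) (K : 'M[R]_(d2, d1))
    (hs : 'cV[R]_d2 -> \bar R) (sigma tau : R) (delay : nat -> 'I_N -> nat)
    (x : nat -> 'cV[R]_d1) (y : nat -> 'cV[R]_d2) : Prop :=
  forall k : nat,
    x k.+1 = x k - sigma *: (\sum_(i < N) grad (f i) (x (k - delay k i)%N))
                 - sigma *: (K^T *m (2 *: y k - y k.-1)) /\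
    prox (fun u => (tau%:E * hs u)%E) (y k + tau *: (K *m x k.+1)) (y k.+1).

Definition avg (R : realType) (d : nat) (x : nat -> 'cV[R]_d) (M : nat) :
  'cV[R]_d := M%:R^-1 *: \sum_(1 <= k < M.+1) x k.

(* Main.v *)
Require Import Defs.
From HB Require Import structures.
From mathcomp Require Import all_boot all_order all_algebra.
From mathcomp Require Import all_classical all_reals all_analysis.
From mathcomp Require Import ring lra.
Import Order.TTheory GRing.Theory Num.Theory.
Import numFieldNormedType.Exports.

Set Implicit Arguments.
Unset Strict Implicit.
Unset Printing Implicit Defensive.

Local Open Scope classical_set_scope.
Local Open Scope ring_scope.

(** Write [kappa] for [sqrt (tau * sigma) * opnorm K], [D k] for
    [|x_(k+1) - x_k|^2] and [E k] for [|y_k - y_(k-1)|^2].  For every reference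
    point [(u, v)] with [v] in the domain of [h*], one iteration gives

      gap at (x_(k+1), y_(k+1))  +  a * D k / (2 sigma)
        +  (1 - kappa) * E (k+1) / (2 tau)   <=   V_k - V_(k+1)

    where [gap] is [L(x_(k+1), v) - L(u, y_(k+1))], where [a] is
    [1 - kappa - sigma * L * (T+1)^2], positive by the step-size condition, and
    where the Lyapunov function [V_k] is the weighted squared distance from
    [(x_k, y_k)] to [(u, v)], minus the coupling [<K (x_k - u), y_k - y_(k-1)>],
    plus [kappa * E k / (2 tau)], plus a multiple of a weighted sum of the last
    [T] values of [D] ([lyapunov], [lyapunov_decrease]).  Three ingredients meet
    there.  Convexity and smoothness bound [f (x_(k+1)) - f u] by the
    aggregated delayed gradient plus the squared displacements over at most
    [T + 1] steps ([delayed_descent]); the proximal step satisfies the usual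
    variational inequality ([prox_variational]); and the extrapolation
    [2 y_k - y_(k-1)] makes the bilinear terms telescope up to one term, which
    Young's inequality absorbs ([coupling_young]).  The delayed displacements
    telescope as well, because [D] summed over the last [T + 1] steps is
    [(T + 1) * D k] plus the decrease of the weighted sum contained in [V_k]
    ([recent_travelS]).

    The same Young inequality bounds [V_k] from below by a positive multiple of
    the distance, and [V_0] is that distance itself.  Everything follows.

    - At a saddle point the gap is nonnegative, so [V_k] decreases; using the
      leftover [E]-term to complete [kappa] to [1] in Young's inequality gives
      the constant of the boundedness estimate ([energy_bound]).
    - Summing the gaps and applying Jensen's inequality bounds the gap at the
      averages by [V_0 / M] ([ergodic_gap_le]), which yields the estimate for
      the partial primal-dual gap.
    - If all gaps at a sequence are asymptotically nonpositive, its cluster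
      points are saddle points, because the epigraph of [h*] is closed
      ([saddle_of_cluster]).  This applies to the averages.  It also applies to
      the iterates: at a saddle point [V_k] converges and the increments
      vanish, hence [V_k - V_(k+1)] vanishes for every reference point, since
      changing the reference point changes [V_k] by an affine function of the
      iterates and of their last increments ([iterates_cluster_saddle]).
    - The iterates are bounded, so they have a cluster point, a saddle point by
      the above.  With it as reference point [V_k] decreases and comes
      arbitrarily close to zero, so the whole sequence converges to it
      ([iterates_cvg_of_cluster]). *)

(** * Euclidean geometry *)

Section Euclidean.
Context {R : realType}.
Implicit Types d m n : nat.

Lemma dotpC d (u v : 'cV[R]_d) : dotp u v = dotp v u.
Proof. by apply: eq_bigr => i _; rewrite mulrC. Qed.

Lemma dotpDl d (u v w : 'cV[R]_d) : dotp (u + v) w = dotp u w + dotp v w.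
Proof. by rewrite /dotp -big_split; apply: eq_bigr => i _; rewrite mxE mulrDl. Qed.

Lemma dotpZl d a (u w : 'cV[R]_d) : dotp (a *: u) w = a * dotp u w.
Proof. by rewrite /dotp mulr_sumr; apply: eq_bigr => i _; rewrite mxE mulrA. Qed.

Lemma dotpNl d (u w : 'cV[R]_d) : dotp (- u) w = - dotp u w.
Proof. by rewrite -scaleN1r dotpZl mulN1r. Qed.

Lemma dotpDr d (u v w : 'cV[R]_d) : dotp w (u + v) = dotp w u + dotp w v.
Proof. by rewrite !(dotpC w) dotpDl. Qed.

Lemma dotpZr d a (u w : 'cV[R]_d) : dotp w (a *: u) = a * dotp w u.
Proof. by rewrite !(dotpC w) dotpZl. Qed.

Lemma dotpNr d (u w : 'cV[R]_d) : dotp w (- u) = - dotp w u.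
Proof. by rewrite !(dotpC w) dotpNl. Qed.

Lemma dotp0r d (w : 'cV[R]_d) : dotp w 0 = 0.
Proof. by rewrite -(scale0r w) dotpZr mul0r. Qed.

Lemma dotp0l d (w : 'cV[R]_d) : dotp 0 w = 0.
Proof. by rewrite dotpC dotp0r. Qed.

Definition dotpE := (dotpDl, dotpDr, dotpNl, dotpNr, dotpZl, dotpZr).

Lemma dotp_suml d (I : finType) (F : I -> 'cV[R]_d) w :
  dotp (\sum_i F i) w = \sum_i dotp (F i) w.
Proof.
elim/big_rec2: _ => [|i a b _ <-]; last by rewrite dotpDl.
by rewrite dotp0l.
Qed.

Lemma dotp_trmx m n (K : 'M[R]_(m, n)) y x :
  dotp (K^T *m y) x = dotp (K *m x) y.
Proof.
rewrite /dotp; under eq_bigr do rewrite mxE mulr_suml.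
under [RHS]eq_bigr do rewrite mxE mulr_suml.
rewrite exchange_big; apply: eq_bigr => i _; apply: eq_bigr => j _ /=.
by rewrite mxE mulrAC.
Qed.

Lemma dotp_ge0 d (u : 'cV[R]_d) : 0 <= dotp u u.
Proof. by apply: sumr_ge0 => i _; rewrite -expr2 sqr_ge0. Qed.

Lemma enorm_ge0 d (u : 'cV[R]_d) : 0 <= enorm u.
Proof. exact: sqrtr_ge0. Qed.

Lemma enorm_sqr d (u : 'cV[R]_d) : enorm u ^+ 2 = dotp u u.
Proof. by rewrite sqr_sqrtr// dotp_ge0. Qed.

Lemma enorm0 d : enorm (0 : 'cV[R]_d) = 0.
Proof. by rewrite /enorm dotp0l sqrtr0. Qed.

Lemma enormZ d a (u : 'cV[R]_d) : enorm (a *: u) = `|a| * enorm u.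
Proof.
by rewrite /enorm dotpZl dotpZr mulrA -expr2 sqrtrM ?sqr_ge0// sqrtr_sqr.
Qed.

Lemma enormN d (u : 'cV[R]_d) : enorm (- u) = enorm u.
Proof. by rewrite -scaleN1r enormZ normrN1 mul1r. Qed.

Lemma coord_le_enorm d (u : 'cV[R]_d) i : `|u i 0| <= enorm u.
Proof.
rewrite -sqrtr_sqr ler_wsqrtr// /dotp (bigD1 i)//= -expr2 lerDl.
by apply: sumr_ge0 => j _; rewrite -expr2 sqr_ge0.
Qed.

Lemma enorm_eq0 d (u : 'cV[R]_d) : enorm u = 0 -> u = 0.
Proof.
move=> u0; apply/colP => i; rewrite [RHS]mxE; apply/eqP.
by rewrite -normr_le0 -u0 coord_le_enorm.
Qed.

Lemma CauchySchwarz_enorm d (u v : 'cV[R]_d) : dotp u v <= enorm u * enorm v.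
Proof.
have [u0|u0] := eqVneq (enorm u) 0.
  by rewrite u0 (enorm_eq0 u0) dotp0l mul0r.
have [v0|v0] := eqVneq (enorm v) 0.
  by rewrite v0 (enorm_eq0 v0) dotp0r mulr0.
have up : 0 < enorm u by rewrite lt_neqAle eq_sym u0 enorm_ge0.
have vp : 0 < enorm v by rewrite lt_neqAle eq_sym v0 enorm_ge0.
have := dotp_ge0 (enorm v *: u - enorm u *: v).
rewrite !dotpE (dotpC v u) -!enorm_sqr => h.
rewrite -(ler_pM2l (mulr_gt0 up vp)); nra.
Qed.

Lemma young_dotp d (u v : 'cV[R]_d) a :
  0 < a -> 2 * dotp u v <= a * enorm u ^+ 2 + a^-1 * enorm v ^+ 2.
Proof.
move=> a0; have := dotp_ge0 (a *: u - v); rewrite !dotpE (dotpC v u) -!enorm_sqr.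
move=> h; rewrite -(ler_pM2l a0) mulrDr mulVKf ?gt_eqF//; lra.
Qed.

(** The Frobenius norm of [K] is a bound, by Cauchy-Schwarz on each row.  This
    makes the supremum [opnorm K] an upper bound. *)
Lemma mulmx_enorm_bounded m n (K : 'M[R]_(m, n)) :
  has_ubound [set enorm (K *m x) | x in [set x : 'cV[R]_n | enorm x <= 1]].
Proof.
exists (Num.sqrt (\sum_(i < m) enorm (row i K)^T ^+ 2)) => _ [x /= x1 <-].
rewrite ler_wsqrtr// /dotp; apply: ler_sum => i _; rewrite -expr2.
have Kx (v : 'cV[R]_n) : (K *m v) i 0 = dotp (row i K)^T v.
  by rewrite mxE; apply: eq_bigr => j _; rewrite !mxE.
have le1 (v : 'cV[R]_n) : enorm v <= 1 -> (K *m v) i 0 <= enorm (row i K)^T.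
  move=> v1; rewrite Kx (le_trans (CauchySchwarz_enorm _ _))//.
  by rewrite ler_piMr// enorm_ge0.
have := le1 x x1; have := le1 (- x).
rewrite enormN => /(_ x1); rewrite mulmxN mxE => ? ?.
have := enorm_ge0 (row i K)^T; nra.
Qed.

Lemma opnorm_ge0 m n (K : 'M[R]_(m, n)) : 0 <= opnorm K.
Proof.
apply: (le_trans (enorm_ge0 (K *m 0))); apply: ub_le_sup.
  exact: mulmx_enorm_bounded.
by exists 0 => //=; rewrite enorm0.
Qed.

Lemma enorm_mulmx_le m n (K : 'M[R]_(m, n)) x :
  enorm (K *m x) <= opnorm K * enorm x.
Proof.
have [x0|x0] := eqVneq (enorm x) 0.
  by rewrite x0 (enorm_eq0 x0) mulmx0 enorm0 mulr0.
have xp : 0 < enorm x by rewrite lt_neqAle eq_sym x0 enorm_ge0.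
rewrite -ler_pdivrMr// mulrC.
have -> : (enorm x)^-1 * enorm (K *m x) = enorm (K *m ((enorm x)^-1 *: x)).
  by rewrite -scalemxAr enormZ gtr0_norm ?invr_gt0.
apply: ub_le_sup; first exact: mulmx_enorm_bounded.
by exists ((enorm x)^-1 *: x) => //=; rewrite enormZ gtr0_norm ?invr_gt0// mulVf.
Qed.

(** Cauchy-Schwarz, the operator norm and Young's inequality, in the weights of
    the step sizes.  With [kappa] for the square root of [a * b], two choices of
    [(a, b)] are used: [(kappa, kappa)], and [(kappa ^+ 2, 1)] where the whole
    second square can be spent to save on the first. *)
Lemma coupling_young m n (K : 'M[R]_(m, n)) x y s t a b :
  0 < s -> 0 < t -> 0 <= a -> 0 <= b -> a * b = (Num.sqrt (t * s) * opnorm K) ^+ 2 ->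
  dotp (K *m x) y <= a * (enorm x ^+ 2 / (2 * s)) + b * (enorm y ^+ 2 / (2 * t)).
Proof.
move=> s0 t0 a0 b0 ab.
have rs0 : 0 < Num.sqrt s by rewrite sqrtr_gt0.
have rt0 : 0 < Num.sqrt t by rewrite sqrtr_gt0.
have ra0 := sqrtr_ge0 a; have rb0 := sqrtr_ge0 b.
have rab : Num.sqrt a * Num.sqrt b = Num.sqrt t * Num.sqrt s * opnorm K.
  rewrite -sqrtrM// ab sqrtr_sqr ger0_norm ?sqrtrM ?(ltW t0)//.
  by rewrite mulr_ge0 ?opnorm_ge0// mulr_ge0// ltW.
have h : dotp (K *m x) y <= opnorm K * enorm x * enorm y.
  apply: (le_trans (CauchySchwarz_enorm _ _)).
  by rewrite ler_wpM2r ?enorm_ge0// enorm_mulmx_le.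
apply: (le_trans h).
rewrite -(sqr_sqrtr a0) -(sqr_sqrtr b0) -{1}(sqr_sqrtr (ltW s0)) -{1}(sqr_sqrtr (ltW t0)).
move: rab rs0 rt0; set A := Num.sqrt a; set B := Num.sqrt b.
set S := Num.sqrt s; set T := Num.sqrt t; set p := enorm x; set q := enorm y.
move=> rab S0 T0.
have -> : opnorm K * p * q = A * B * (p / S) * (q / T).
  by rewrite rab; field; rewrite !gt_eqF.
have -> : A ^+ 2 * (p ^+ 2 / (2 * S ^+ 2)) + B ^+ 2 * (q ^+ 2 / (2 * T ^+ 2))
  = (A * (p / S) - B * (q / T)) ^+ 2 / 2 + A * B * (p / S) * (q / T).
  by field; rewrite !gt_eqF.
by rewrite lerDr divr_ge0 ?sqr_ge0.
Qed.
End Euclidean.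

(** * Convexity, smoothness and the proximal step *)

Section Convexity.
Context {R : realType}.

(** First-order optimality in disguise: convexity and smoothness both produce
    inequalities along a segment with an error of second order in [t], and the
    error disappears as [t] tends to zero. *)
Lemma le_of_small_perturbation (a b c : R) :
  (forall t, 0 < t <= 1 -> a <= b + t * c) -> a <= b.
Proof.
move=> h; rewrite leNgt; apply/negP => ba.
have h1 : a <= b + 1 * c by apply: h; rewrite ltr01 lexx.
have c0 : 0 < c by lra.
(* At this [t] the perturbation is half of the presumed excess [a - b]; it is
   at most 1/2 because [a - b <= c]. *)
have := h ((a - b) / (2 * c)).
have -> : (a - b) / (2 * c) * c = (a - b) / 2 by field; rewrite gt_eqF.
rewrite divr_gt0 ?mulr_gt0 ?subr_gt0// ler_pdivrMr ?mulr_gt0//=.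
have -> : a - b <= 1 * (2 * c) by lra.
by move=> /(_ isT); lra.
Qed.

(** In dimension 0 the constant [l] itself may be negative. *)
Lemma Lsmooth_nonneg d (l : R) (f : 'cV[R]_d -> R) (v : 'cV[R]_d) :
  Lsmooth l f -> 0 <= l * enorm v ^+ 2.
Proof.
move=> /(_ 0 v); rewrite subr0 => h.
have := le_trans (normr_ge0 _) h; lra.
Qed.

Lemma convex_functionP d (f : 'cV[R]_d -> R) :
  convex_function [set: convex_lmodType 'cV[R]_d] f ->
  forall t u v, 0 <= t <= 1 ->
    f (t *: u + (1 - t) *: v) <= t * f u + (1 - t) * f v.
Proof.
move=> cf t u v /andP[t0 t1].
by have := cf (Itv01 t0 t1) u v; rewrite !inE; apply.
Qed.

(** Smoothness gives the first-order expansion of [f] along the segment from [u]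
    to [v] and convexity bounds the same values by the chord; the inequality is
    the limit at [u] of their comparison. *)
Lemma convex_gradient_le d (l : R) (f : 'cV[R]_d -> R) u v :
  convex_function [set: convex_lmodType 'cV[R]_d] f -> Lsmooth l f ->
  f u + dotp (grad f u) (v - u) <= f v.
Proof.
move=> /convex_functionP cf lf.
apply: (@le_of_small_perturbation _ _ (l / 2 * enorm (v - u) ^+ 2)) => t /andP[t0 t1].
have := lf u (t *: v + (1 - t) *: u).
have -> : t *: v + (1 - t) *: u - u = t *: (v - u).
  by apply/colP => i; rewrite !mxE; ring.
rewrite dotpZr enormZ exprMn real_normK ?num_real// ler_norml => /andP[h _].
have := cf t v u; rewrite (ltW t0) t1 => /(_ isT) h'.
rewrite -(ler_pM2l t0); lra.
Qed.

(** The gradient may be taken at a third point [u], at the price of the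
    quadratic term at [w]: this is what makes stale gradients usable. *)
Lemma convex_smooth_three_point d (l : R) (f : 'cV[R]_d -> R) u v w :
  convex_function [set: convex_lmodType 'cV[R]_d] f -> Lsmooth l f ->
  f w - f v <= dotp (grad f u) (w - v) + l / 2 * enorm (w - u) ^+ 2.
Proof.
move=> cf lf; have := convex_gradient_le u v cf lf.
have := lf u w; rewrite ler_norml => /andP[_].
rewrite !dotpE; lra.
Qed.

Lemma convex_efun_fine d (h : 'cV[R]_d -> \bar R) t u v :
  proper_efun h -> convex_efun h -> 0 <= t <= 1 ->
  h u \is a fin_num -> h v \is a fin_num ->
  h (t *: u + (1 - t) *: v) \is a fin_num /\
  fine (h (t *: u + (1 - t) *: v)) <= t * fine (h u) + (1 - t) * fine (h v).
Proof.
move=> [hN _] ch t01 hu hv; have := ch t u v t01.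
rewrite -(fineK hu) -(fineK hv) -!EFinM -EFinD.
have := hN (t *: u + (1 - t) *: v).
by case: (h (_ + _)) => // r _; rewrite lee_fin.
Qed.

(** A minimizer of [t * h + |. - z|^2 / 2] has a finite value because [h] is
    finite somewhere.  Comparing it with the points of a segment towards [v]
    says that [(z - p) / t] is a subgradient of [h] at [p]. *)
Lemma prox_variational d (h : 'cV[R]_d -> \bar R) t z p :
  proper_efun h -> convex_efun h -> 0 < t ->
  prox (fun u => (t%:E * h u)%E) z p ->
  h p \is a fin_num /\
  forall v, h v \is a fin_num ->
    fine (h p) - fine (h v) <= dotp (z - p) (p - v) / t.
Proof.
move=> ph ch t0 pp; have [hN [v0 hv0]] := ph.
have fin v : h v != +oo%E -> h v \is a fin_num.
  by move=> hv; rewrite fin_numE hN.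
have hp : h p \is a fin_num.
  apply: (fin p); apply/eqP => hp; have := pp v0.
  by rewrite hp gt0_muley ?lte_fin// -(fineK (fin _ hv0)) -EFinM -EFinD.
split=> // v hv; rewrite ler_pdivlMr//.
apply: (@le_of_small_perturbation _ _ (2^-1 * enorm (v - p) ^+ 2)) => s /andP[s0 s1].
have s01 : 0 <= s <= 1 by rewrite (ltW s0).
have [hw cw] := convex_efun_fine ph ch s01 hv hp.
have := pp (s *: v + (1 - s) *: p).
rewrite -(fineK hw) -(fineK hp) -!EFinM -!EFinD lee_fin.
have -> : s *: v + (1 - s) *: p - z = s *: (v - p) + (p - z).
  by apply/colP => i; rewrite !mxE; ring.
rewrite !enorm_sqr !dotpE !(dotpC _ v) !(dotpC z p) => h1.
rewrite -(ler_pM2l s0).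
have : t * fine (h (s *: v + (1 - s) *: p))
    <= t * (s * fine (h v) + (1 - s) * fine (h p)).
  by rewrite ler_pM2l.
nra.
Qed.

End Convexity.

(** * Topology of column vectors *)

Section EuclideanTopology.
Context {R : realType}.

Lemma norm_le_of_coord m n (A : 'M[R]_(m, n)) c :
  0 <= c -> (forall i j, `|A i j| <= c) -> `|A| <= c.
Proof.
move=> c0 Ac; rewrite [leLHS]/Num.norm /= mx_normrE.
by apply/bigmax_leP; split=> // -[i j] _; apply: Ac.
Qed.

Lemma norm_le_enorm d (u : 'cV[R]_d) : `|u| <= enorm u.
Proof.
apply: norm_le_of_coord => [|i j]; first exact: enorm_ge0.
by rewrite ord1 coord_le_enorm.
Qed.

Lemma continuous_trmx m n : continuous (fun A : 'M[R]_(m, n) => A^T).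
Proof.
move=> A B [P AP PB]; exists (fun i j => P j i) => [i j|C CP].
  by have := AP j i; rewrite mxE.
by apply: PB => i j; rewrite mxE; apply: CP.
Qed.

(** A box of row vectors is compact by Tychonoff's theorem, and transposition is
    continuous. *)
Lemma compact_coord_bounded d (c : R) :
  compact [set u : 'cV[R]_d | forall i, `|u i 0| <= c].
Proof.
have -> : [set u : 'cV[R]_d | forall i, `|u i 0| <= c] =
  (fun v : 'rV[R]_d => v^T) @` [set v : 'rV[R]_d | forall i, `[- c, c]%classic (v 0 i)].
  apply/seteqP; split=> [u uc|_ [v vc <-] i].
    exists u^T => [i|]; last by rewrite trmxK.
    by rewrite /= mxE in_itv /= -ler_norml.
  by rewrite mxE; have := vc i; rewrite /= in_itv /= -ler_norml.
apply: continuous_compact; last first.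
  apply: (@rV_compact _ _ (fun=> `[- c, c]%classic)) => _.
  exact: segment_compact.
by apply: continuous_subspaceT; apply: continuous_trmx.
Qed.

Lemma continuous_sum (U : topologicalType) (I : finType) (F : I -> U -> R) :
  (forall i, continuous (F i)) -> continuous (fun u => \sum_i F i u).
Proof.
have addc : continuous (fun p : R * R => p.1 + p.2) := add_continuous.
by move=> cF; apply: (@continuous_big _ _ _ 0 xpredT addc).
Qed.

Lemma continuous_dotp d (w : 'cV[R]_d) : continuous (dotp w).
Proof.
rewrite (_ : dotp w = fun u => \sum_(i < d) w i 0 * u i 0); last exact/funext.
apply: continuous_sum => i u.
by apply: continuousM; [exact: cst_continuous|exact: coord_continuous].
Qed.

Lemma continuous_enorm_sqr d (w : 'cV[R]_d) :
  continuous (fun u : 'cV[R]_d => enorm (u - w) ^+ 2).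
Proof.
have -> : (fun u : 'cV[R]_d => enorm (u - w) ^+ 2) =
    (fun u : 'cV[R]_d => dotp u u + (dotp w w - 2 * dotp w u)).
  by apply/funext => u; rewrite enorm_sqr !dotpE (dotpC u w); ring.
have c1 : continuous (fun u : 'cV[R]_d => dotp u u).
  apply: (@continuous_sum _ _ (fun i (u : 'cV[R]_d) => u i 0 * u i 0)) => i u.
  by apply: continuousM; exact: coord_continuous.
move=> u; apply: (@continuousD R R 'cV[R]_d (fun u => dotp u u)
  (fun u => dotp w w - 2 * dotp w u)); first exact: c1.
apply: (@continuousB R R 'cV[R]_d (fun=> dotp w w) (fun u => 2 * dotp w u)).
  exact: cst_continuous.
by apply: (@continuousM _ _ (cst 2)); [exact: cst_continuous|exact: continuous_dotp].
Qed.

Lemma cvg_enorm_sqr d (z : nat -> 'cV[R]_d) l :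
  enorm (z k - l) ^+ 2 @[k --> \oo] --> 0 -> z @ \oo --> l.
Proof.
move=> h; apply/cvgrPdist_le => e e0; near=> k.
apply: (le_trans (norm_le_enorm _)).
rewrite -(@ler_pXn2r _ 2)// ?nnegrE ?enorm_ge0 ?(ltW e0)//.
rewrite -enormN opprB -[leLHS]ger0_norm ?sqr_ge0//.
near: k; apply: cvgr0_norm_le => //; exact: exprn_gt0.
Unshelve. all: by end_near. Qed.

Lemma cvg0_dominated (u v : nat -> R) c :
  0 < c -> (forall k, 0 <= u k) -> (forall k, c * u k <= v k) ->
  v @ \oo --> 0 -> u @ \oo --> 0.
Proof.
move=> c0 u0 uv v0; apply: (@squeeze_cvgr _ _ _ _ (cst 0) (fun k => c^-1 * v k)).
- by apply: nearW => k; rewrite u0 -(ler_pM2l c0) mulVKf ?gt_eqF// uv.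
- exact: cvg_cst.
- by rewrite -(mulr0 c^-1); apply: cvgMr.
Qed.

End EuclideanTopology.

(** * Saddle points and duality gaps *)

(** Jensen's inequality for the uniform average, on a convex set [D]: the next
    average is a convex combination of the next point and the previous
    average. *)
Lemma convex_avg (R : realType) d (D : set 'cV[R]_d) (phi : 'cV[R]_d -> R) z :
  (forall t u v, 0 <= t <= 1 -> D u -> D v ->
    D (t *: u + (1 - t) *: v) /\
    phi (t *: u + (1 - t) *: v) <= t * phi u + (1 - t) * phi v) ->
  (forall k, D (z k.+1)) ->
  forall M, D (avg z M.+1) /\
    phi (avg z M.+1) <= M.+1%:R^-1 * \sum_(k < M.+1) phi (z k.+1).
Proof.
move=> cD Dz; elim=> [|M [IHD IH]].
  by rewrite /avg big_nat1 invr1 scale1r mul1r big_ord1.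
have M2 : M.+2%:R != 0 :> R by rewrite pnatr_eq0.
have M1 : M.+1%:R != 0 :> R by rewrite pnatr_eq0.
have e2 : M.+2%:R = M.+1%:R + 1 :> R by rewrite -natr1.
have wE : M.+2%:R^-1 = (1 - M.+2%:R^-1) * M.+1%:R^-1 :> R.
  move: M2; rewrite e2; move: (M.+1%:R : R) M1 => a a0 a1.
  by field; rewrite a0 a1.
have avgS : avg z M.+2 = M.+2%:R^-1 *: z M.+2 + (1 - M.+2%:R^-1) *: avg z M.+1.
  rewrite /avg big_nat_recr//= scalerDr addrC; congr (_ + _).
  by rewrite scalerA -wE.
have t01 : 0 <= (M.+2%:R^-1 : R) <= 1.
  by rewrite invr_ge0 ler0n invf_le1 ?ltr0n// ler1n.
rewrite avgS; have [h1 h2] := cD _ _ _ t01 (Dz M.+1) IHD; split=> //.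
apply: (le_trans h2); rewrite [in leRHS]big_ord_recr /= mulrDr addrC.
rewrite lerD2r.
apply: le_trans (_ : (1 - M.+2%:R^-1)
  * (M.+1%:R^-1 * \sum_(k < M.+1) phi (z k.+1)) <= _).
  by rewrite ler_wpM2l// subr_ge0; case/andP: t01.
by rewrite mulrA -wE.
Qed.

Section SaddlePoints.
Context {R : realType} {d1 d2 : nat}.
Variables (F : 'cV[R]_d1 -> R) (K : 'M[R]_(d2, d1)) (hs : 'cV[R]_d2 -> \bar R).
Hypothesis hs_proper : proper_efun hs.

(** The Lagrangian difference [L(u, v') - L(u', v)], in real numbers; it is
    meaningful where [hs v] and [hs v'] are finite. *)
Definition duality_gap (u : 'cV[R]_d1) (v : 'cV[R]_d2)
    (u' : 'cV[R]_d1) (v' : 'cV[R]_d2) : R :=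
  (F u + dotp (K *m u) v' - fine (hs v'))
  - (F u' + dotp (K *m u') v - fine (hs v)).

Lemma proper_fin v : hs v != +oo%E -> hs v \is a fin_num.
Proof. by move=> hv; rewrite fin_numE hv (proj1 hs_proper). Qed.

Lemma lagrangian_fin u v : hs v \is a fin_num ->
  lagrangian F K hs u v = (F u + dotp (K *m u) v - fine (hs v))%:E.
Proof. by move=> hv; rewrite /lagrangian -{1}(fineK hv) EFinB. Qed.

Lemma lagrangian_pinfty u v : hs v = +oo%E -> lagrangian F K hs u v = -oo%E.
Proof. by move=> hv; rewrite /lagrangian hv. Qed.

Lemma saddle_dual_fin u v :
  saddle_point (lagrangian F K hs) u v -> hs v \is a fin_num.
Proof.
move=> S; have [_ [v0 hv0]] := hs_proper.
apply: proper_fin; apply/eqP => hv; have [] := S u v0.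
by rewrite (lagrangian_pinfty _ hv) (lagrangian_fin _ (proper_fin hv0)).
Qed.

Lemma saddle_gap_ge0 uh vh u v :
  saddle_point (lagrangian F K hs) uh vh -> hs v \is a fin_num ->
  0 <= duality_gap u v uh vh.
Proof.
move=> S hv; have hvh := saddle_dual_fin S.
have [] := S u v; rewrite !lagrangian_fin// !lee_fin /duality_gap; lra.
Qed.

(** The hypothesis is [L(u, v') <= L(u', v)] solved for [hs v], a form in which
    finiteness of [hs v] need not be known beforehand; the choices [u' = u] and
    [v' = v] are the two saddle inequalities. *)
Lemma saddle_of_dual_bound u v :
  (forall u' v', hs v' \is a fin_num ->
    (hs v <= (F u' + dotp (K *m u') v
              - (F u + dotp (K *m u) v' - fine (hs v')))%:E)%E) ->
  saddle_point (lagrangian F K hs) u v.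
Proof.
move=> B; have [_ [v0 /proper_fin hv0]] := hs_proper.
have hv : hs v \is a fin_num.
  by apply: proper_fin; apply/eqP => hv; have := B u v0 hv0; rewrite hv leye_eq.
have B' u' v' : hs v' \is a fin_num ->
    (lagrangian F K hs u v' <= lagrangian F K hs u' v)%E.
  move=> hv'; have := B u' v' hv'; rewrite -{1}(fineK hv).
  rewrite !lagrangian_fin// !lee_fin; lra.
move=> u' v'; split; last exact: B'.
have [/lagrangian_pinfty ->|/proper_fin/B'//] := eqVneq (hs v') +oo%E.
by rewrite leNye.
Qed.

(** For finite [D], the infimum over [B1] cannot be [-oo] unless the supremum
    over [B2] is [-oo] too, in which case the difference is [-oo]; otherwise the
    supremum and the infimum are controlled by a single pair of points at a
    time. *)
Lemma pd_gap_le (B1 : set 'cV[R]_d1) (B2 : set 'cV[R]_d2) p q (D : \bar R) :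
  hs q \is a fin_num -> B1 !=set0 -> (0 <= D)%E ->
  (forall u v, B1 u -> B2 v -> hs v \is a fin_num ->
    ((duality_gap p q u v)%:E <= D)%E) ->
  (pd_gap (lagrangian F K hs) B1 B2 p q <= D)%E.
Proof.
move=> hq [u0 B1u0]; case: D => [r|_ _|//]; last by rewrite leey.
move=> r0 h; rewrite /pd_gap.
set S := ereal_sup _; set I := ereal_inf _.
have SL u : B1 u -> (S <= lagrangian F K hs u q + r%:E)%E.
  move=> B1u; apply: ge_ereal_sup => _ [v B2v <-].
  have [/lagrangian_pinfty ->|/proper_fin hv] := eqVneq (hs v) +oo%E.
    by rewrite leNye.
  have := h u v B1u B2v hv.
  rewrite !lagrangian_fin// -EFinD !lee_fin /duality_gap; lra.
have SI : (S - r%:E <= I)%E.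
  by apply: le_ereal_inf_tmp => _ [u B1u <-]; rewrite leeBlDr// SL.
have IL : (I <= lagrangian F K hs u0 q)%E by apply: ereal_inf_lbound; exists u0.
have := SL _ B1u0; move: SI IL; rewrite lagrangian_fin//.
case: S {SL} => [s| |]; case: I => [i| |] //=.
- by rewrite -!EFinD !lee_fin => ? _ _; lra.
- by move=> _ _ _; rewrite leNye.
- by move=> _ _ _; rewrite leNye.
Qed.

Section Cluster.
Hypothesis F_continuous : continuous F.
Hypothesis hs_closed : closed_efun hs.

(** For each [eps], the tail of the sequence lies in the set where
    [hs w.2 <= bound w + const + eps].  This set is closed, as the preimage of
    the epigraph under a continuous map, so it contains the cluster points; then
    [eps] tends to zero.  The index starts at 1 because [q 0] may lie outside
    the domain of [hs]. *)
Lemma saddle_of_cluster (p : nat -> 'cV[R]_d1) (q : nat -> 'cV[R]_d2) z :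
  (forall n, hs (q n.+1) \is a fin_num) ->
  (forall u v, hs v \is a fin_num ->
    exists2 e : nat -> R, e @ \oo --> 0 &
      forall n, duality_gap (p n.+1) (q n.+1) u v <= e n) ->
  cluster ((fun n => (p n, q n)) @ \oo) z ->
  saddle_point (lagrangian F K hs) z.1 z.2.
Proof.
move=> hq gap_small z_cluster; apply: saddle_of_dual_bound => u v hv.
have [e e0 gap_e] := gap_small u v hv.
pose bound (w : 'cV[R]_d1 * 'cV[R]_d2) : R :=
  dotp (K *m u) w.2 - (F w.1 + dotp (K^T *m v) w.1).
have bound_cont : continuous bound.
  move=> w.
  apply: (@continuousB R R _ (fun w : 'cV[R]_d1 * 'cV[R]_d2 => dotp (K *m u) w.2)
    (fun w => F w.1 + dotp (K^T *m v) w.1)).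
    by apply: continuous_comp; [exact: cvg_snd|exact: continuous_dotp].
  apply: (@continuousD R R _ (fun w : 'cV[R]_d1 * 'cV[R]_d2 => F w.1)
    (fun w => dotp (K^T *m v) w.1)).
    by apply: continuous_comp; [exact: cvg_fst|exact: F_continuous].
  by apply: continuous_comp; [exact: cvg_fst|exact: continuous_dotp].
apply/lee_addgt0Pr => eps eps0; rewrite -EFinD.
pose C (w : 'cV[R]_d1 * 'cV[R]_d2) : 'cV[R]_d2 * R :=
  (w.2, bound w + (F u + fine (hs v) + eps)).
have C_cont : continuous C.
  move=> w; have c1 : snd @ nbhs w --> w.2 by exact: cvg_snd.
  suff c2 : bound w' + (F u + fine (hs v) + eps) @[w' --> w] -->
      bound w + (F u + fine (hs v) + eps) by exact: (cvg_pair c1 c2).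
  apply: (@continuousD R R _ bound (fun=> F u + fine (hs v) + eps)).
    exact: bound_cont.
  exact: cst_continuous.
have : (C @^-1` epigraph hs) z.
  apply: (preimage_closed (fun w _ => C_cont w) hs_closed).
  move: z_cluster; rewrite clusterE; apply.
  have /cvgr0_norm_lt /(_ _ eps0) [n0 _ en0] := e0.
  exists n0.+1 => // -[//|n] /= nn0; rewrite /epigraph /=.
  have := gap_e n; have := en0 n nn0; rewrite ltr_norml => /andP[_ en].
  rewrite -(fineK (hq n)) lee_fin /duality_gap /bound /= dotp_trmx; lra.
rewrite /epigraph /= /bound dotp_trmx => h; apply: (le_trans h).
rewrite lee_fin; lra.
Qed.
End Cluster.
End SaddlePoints.

(** * Displacements under bounded delays *)

Section Delays.
Context {R : realType} {d : nat}.
Implicit Types (x : nat -> 'cV[R]_d) (T : nat).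

(** Cumulated squared displacements, so that the squared displacements over any
    window of iterations are a difference of two values. *)
Definition travel x k : R := \sum_(j < k) enorm (x j.+1 - x j) ^+ 2.

(** The sum over [0 <= m <= T] of the squared displacements of the last [m]
    steps: a step made [j] iterations ago has weight [T - j + 1].  Truncation of
    [k - m] at 0 shortens the windows that would reach before the start. *)
Definition recent_travel T x k : R :=
  \sum_(m < T.+1) (travel x k - travel x (k - m)).

Lemma travelS x k : travel x k.+1 = travel x k + enorm (x k.+1 - x k) ^+ 2.
Proof. by rewrite /travel big_ord_recr. Qed.

Lemma travel_le x a b : (a <= b)%N -> travel x a <= travel x b.
Proof.
elim: b => [|b IH]; first by rewrite leqn0 => /eqP ->.
rewrite leq_eqVlt => /orP[/eqP ->//|/IH h].
by rewrite travelS (le_trans h)// lerDl sqr_ge0.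
Qed.

Lemma recent_travel_ge0 T x k : 0 <= recent_travel T x k.
Proof. by apply: sumr_ge0 => m _; rewrite subr_ge0 travel_le ?leq_subr. Qed.

Lemma recent_travel0 T x : recent_travel T x 0 = 0.
Proof. by apply: big1 => m _; rewrite subrr. Qed.

(** The new step is credited [T + 1] units, and each of the last [T + 1] steps,
    the new one included, is then debited one unit: a step is used up after
    [T + 1] iterations.  The sums over [m] differ only in their extreme terms,
    since the window of length [m + 1] at [k + 1] starts where the window of
    length [m] at [k] does. *)
Lemma recent_travelS T x k :
  recent_travel T x k.+1 = recent_travel T x k
    + (T + 1)%:R * enorm (x k.+1 - x k) ^+ 2
    - (travel x k.+1 - travel x (k - T)).
Proof.
rewrite /recent_travel !sumrB !sumr_const !card_ord.
rewrite [X in _ - X = _]big_ord_recl [X in _ = _ - X + _ - _]big_ord_recr /= subn0.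
under eq_bigr do rewrite /bump /= add1n subSS.
rewrite travelS -[(_ + _) *+ _]mulr_natl -[travel _ _ *+ _]mulr_natl addn1.
ring.
Qed.

(** Cauchy-Schwarz for a sum of [b - a] increments. *)
Lemma enorm_sub_travel x a b : (a <= b)%N ->
  enorm (x b - x a) ^+ 2 <= (b - a)%:R * (travel x b - travel x a).
Proof.
elim: b => [|b IH].
  by rewrite leqn0 => /eqP ->; rewrite !subrr enorm0 expr0n mulr0.
rewrite leq_eqVlt => /orP[/eqP ->|].
  by rewrite !subrr enorm0 expr0n mulr0.
rewrite ltnS => ab; have := IH ab.
rewrite subSn// travelS; have := travel_le x ab.
have -> : x b.+1 - x a = (x b.+1 - x b) + (x b - x a) by rewrite addrA subrK.
move: (x b.+1 - x b) (x b - x a) => p q.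
set W := travel x b - travel x a.
have -> : travel x b + enorm p ^+ 2 - travel x a = W + enorm p ^+ 2.
  by rewrite /W addrAC.
rewrite -subr_ge0 -/W => W0.
have [->|n0] := posnP (b - a)%N.
  rewrite mul0r mul1r => q0; have /enorm_eq0 -> : enorm q = 0.
    by apply/eqP; rewrite -sqrf_eq0 eq_le q0 sqr_ge0.
  by rewrite addr0 lerDr.
move=> q2; have nR : 0 < (b - a)%:R :> R by rewrite ltr0n.
have := young_dotp p q nR.
have : (b - a)%:R^-1 * enorm q ^+ 2 <= W by rewrite mulrC ler_pdivrMr// mulrC.
rewrite [enorm (p + q) ^+ 2]enorm_sqr !dotpE (dotpC q p) -!enorm_sqr -addn1 natrD.
lra.
Qed.

Lemma delayed_enorm_le T x k j : (j <= T)%N ->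
  enorm (x k.+1 - x (k - j)%N) ^+ 2
    <= (T + 1)%:R * (travel x k.+1 - travel x (k - T)).
Proof.
move=> jT; have kj : (k - j <= k.+1)%N by rewrite (leq_trans (leq_subr _ _)).
apply: (le_trans (enorm_sub_travel x kj)).
apply: ler_pM => //; first by rewrite subr_ge0 travel_le.
  rewrite ler_nat addn1 leq_subLR addnS ltnS -leq_subLR (leq_trans _ jT)//.
  by rewrite leq_subLR addnC -leq_subLR.
by rewrite lerD2l lerN2 travel_le// leq_sub2l.
Qed.

(** Each [f i] is compared through the gradient at its own delayed point.  In
    dimension 0 the constants may be negative, but there all displacements
    vanish. *)
Lemma delayed_descent N (f : 'I_N -> 'cV[R]_d -> R) (L : 'I_N -> R) T x k
    (j : 'I_N -> nat) v :
  (forall i, convex_function [set: convex_lmodType 'cV[R]_d] (f i)) ->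
  (forall i, Lsmooth (L i) (f i)) ->
  (forall i, (j i <= T)%N) ->
  \sum_(i < N) f i (x k.+1) - \sum_(i < N) f i v
    <= dotp (\sum_(i < N) grad (f i) (x (k - j i)%N)) (x k.+1 - v)
       + (\sum_(i < N) L i) * (T + 1)%:R / 2
         * (travel x k.+1 - travel x (k - T)).
Proof.
move=> cf lf jT; rewrite dotp_suml -sumrB !mulr_suml -big_split /=.
apply: ler_sum => i _.
apply: (le_trans (convex_smooth_three_point (x (k - j i)%N) v (x k.+1) (cf i) (lf i))).
rewrite lerD2l; have B := delayed_enorm_le x k (jT i).
have [l0|l0] := leP 0 (L i).
  have := ler_wpM2l l0 B; lra.
have e0 (w : 'cV[R]_d) : enorm w ^+ 2 = 0 :> R.
  apply/eqP; rewrite eq_le sqr_ge0 andbT.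
  have := Lsmooth_nonneg w (lf i).
  by rewrite nmulr_rge0.
have t0 n : travel x n = 0 by apply: big1 => m _; apply: e0.
by rewrite e0 !t0 subrr !mulr0.
Qed.

End Delays.

(** * The Lyapunov function *)

Lemma three_point_identity (R : realType) d (p q u : 'cV[R]_d) :
  2 * dotp (p - q) (q - u)
    = enorm (p - u) ^+ 2 - enorm (q - u) ^+ 2 - enorm (q - p) ^+ 2.
Proof.
rewrite !enorm_sqr !dotpE (dotpC q p) (dotpC u p) (dotpC u q); ring.
Qed.

Definition energy (R : realType) d1 d2 (s t : R) (u : 'cV[R]_d1) (v : 'cV[R]_d2) : R :=
  enorm u ^+ 2 / (2 * s) + enorm v ^+ 2 / (2 * t).

Lemma continuous_energy (R : realType) d1 d2 (s t : R)
    (a : 'cV[R]_d1) (b : 'cV[R]_d2) :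
  continuous (fun w : 'cV[R]_d1 * 'cV[R]_d2 => energy s t (w.1 - a) (w.2 - b)).
Proof.
move=> w; apply: (@continuousD R R _
  (fun w : 'cV[R]_d1 * 'cV[R]_d2 => enorm (w.1 - a) ^+ 2 / (2 * s))
  (fun w => enorm (w.2 - b) ^+ 2 / (2 * t))).
  apply: (@continuousM R _ (fun w : 'cV[R]_d1 * 'cV[R]_d2 =>
    enorm (w.1 - a) ^+ 2) (cst _)); last exact: cst_continuous.
  apply: (@continuous_comp _ _ _ (fun w : 'cV[R]_d1 * 'cV[R]_d2 => w.1)
    (fun u : 'cV[R]_d1 => enorm (u - a) ^+ 2)).
    exact: cvg_fst.
  exact: continuous_enorm_sqr.
apply: (@continuousM R _ (fun w : 'cV[R]_d1 * 'cV[R]_d2 =>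
  enorm (w.2 - b) ^+ 2) (cst _)); last exact: cst_continuous.
apply: (@continuous_comp _ _ _ (fun w : 'cV[R]_d1 * 'cV[R]_d2 => w.2)
  (fun v : 'cV[R]_d2 => enorm (v - b) ^+ 2)).
  exact: cvg_snd.
exact: continuous_enorm_sqr.
Qed.

Section Iteration.
Context {R : realType} {d1 d2 N : nat}.
Variables (f : 'I_N -> 'cV[R]_d1 -> R) (L : 'I_N -> R).
Variables (K : 'M[R]_(d2, d1)) (hs : 'cV[R]_d2 -> \bar R).
Variables (T : nat) (delay : nat -> 'I_N -> nat) (sigma tau : R).
Variables (x : nat -> 'cV[R]_d1) (y : nat -> 'cV[R]_d2).

Hypothesis f_convex :
  forall i, convex_function [set: convex_lmodType 'cV[R]_d1] (f i).
Hypothesis f_smooth : forall i, Lsmooth (L i) (f i).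
Hypothesis L_gt0 : 0 < \sum_(i < N) L i.
Hypothesis hs_proper : proper_efun hs.
Hypothesis hs_convex : convex_efun hs.
Hypothesis delay_le : forall k i, (delay k i <= T)%N.
Hypothesis sigma_gt0 : 0 < sigma.
Hypothesis tau_gt0 : 0 < tau.
Hypothesis step : Num.sqrt (tau * sigma) * opnorm K
          + sigma * (\sum_(i < N) L i) * (T + 1)%:R ^+ 2 < 1.
Hypothesis iter : pd_piag f K hs sigma tau delay x y.

Local Notation F := (fun u => \sum_(i < N) f i u).
Local Notation Lag := (lagrangian F K hs).
Local Notation gap := (duality_gap F K hs).
Local Notation kappa := (Num.sqrt (tau * sigma) * opnorm K).
Local Notation Lbar := (\sum_(i < N) L i).

(** The coupling enters with the extrapolated increment [y k - y k.-1]; at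
    [k = 0] both this increment and the delay term vanish, so that the value is
    the plain [energy]. *)
Definition lyapunov u v k : R :=
  energy sigma tau (x k - u) (y k - v)
  - dotp (K *m (x k - u)) (y k - y k.-1)
  + kappa * (enorm (y k - y k.-1) ^+ 2 / (2 * tau))
  + Lbar * (T + 1)%:R / 2 * recent_travel T x k.

Lemma kappa_ge0 : 0 <= kappa.
Proof. by rewrite mulr_ge0 ?sqrtr_ge0 ?opnorm_ge0. Qed.

Lemma kappa_lt1 : kappa < 1.
Proof.
apply: le_lt_trans step; rewrite lerDl mulr_ge0 ?sqr_ge0// mulr_ge0// ltW//.
Qed.

Lemma dual_iterate_fin k : hs (y k.+1) \is a fin_num.
Proof. by have [_ /(prox_variational hs_proper hs_convex tau_gt0)[]] := iter k. Qed.

(** Solve the primal update for the aggregated gradient and use the three-point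
    identity. *)
Lemma gradient_step_identity u k :
  dotp (\sum_(i < N) grad (f i) (x (k - delay k i)%N)) (x k.+1 - u)
  = enorm (x k - u) ^+ 2 / (2 * sigma) - enorm (x k.+1 - u) ^+ 2 / (2 * sigma)
    - enorm (x k.+1 - x k) ^+ 2 / (2 * sigma)
    - dotp (K *m (x k.+1 - u)) (2 *: y k - y k.-1).
Proof.
have [ex _] := iter k; rewrite -dotp_trmx.
set g := (\sum_(i < N) _) in ex *; set w := K^T *m _ in ex *.
have -> : g = sigma^-1 *: (x k - x k.+1) - w.
  rewrite {}ex; move: g w => g w; apply/colP => i; rewrite !mxE; field.
  by rewrite gt_eqF.
rewrite dotpDl dotpNl dotpZl; congr (_ - _).
rewrite -!mulrBl -three_point_identity.
by field; rewrite gt_eqF.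
Qed.

Lemma prox_step_le v k : hs v \is a fin_num ->
  fine (hs (y k.+1)) - fine (hs v)
  <= enorm (y k - v) ^+ 2 / (2 * tau) - enorm (y k.+1 - v) ^+ 2 / (2 * tau)
    - enorm (y k.+1 - y k) ^+ 2 / (2 * tau)
    + dotp (K *m x k.+1) (y k.+1 - v).
Proof.
move=> hv.
have [_ /(prox_variational hs_proper hs_convex tau_gt0)[_ /(_ v hv)]] := iter k.
move=> /le_trans; apply.
have -> : y k + tau *: (K *m x k.+1) - y k.+1
  = (y k - y k.+1) + tau *: (K *m x k.+1) by rewrite addrAC.
rewrite dotpDl dotpZl mulrDl [tau * _]mulrC mulfK ?gt_eqF// lerD2r.
rewrite -!mulrBl -three_point_identity.
by rewrite le_eqVlt; apply/orP; left; apply/eqP; field; rewrite gt_eqF.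
Qed.

(** The one-step inequality on which everything rests.  The bilinear terms
    reduce to a telescoping difference plus [<K (x_k - x_(k+1)), y_k - y_(k-1)>],
    because the extrapolated point predicts [y_(k+1)]; Young's inequality charges
    [kappa] to each of the two increments. *)
Lemma lyapunov_decrease u v k : hs v \is a fin_num ->
  gap (x k.+1) (y k.+1) u v
  + (1 - kappa - sigma * Lbar * (T + 1)%:R ^+ 2)
     * (enorm (x k.+1 - x k) ^+ 2 / (2 * sigma))
  + (1 - kappa) * (enorm (y k.+1 - y k) ^+ 2 / (2 * tau))
  <= lyapunov u v k - lyapunov u v k.+1.
Proof.
move=> hv.
have h1 := delayed_descent x k u f_convex f_smooth (delay_le k).
have h2 := prox_step_le k hv.
have k2 : kappa * kappa = kappa ^+ 2 by [].
have := coupling_young (K := K) (x k - x k.+1) (y k - y k.-1) sigma_gt0 tau_gt0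
  kappa_ge0 kappa_ge0 k2.
have -> : enorm (x k - x k.+1) = enorm (x k.+1 - x k).
  by rewrite -enormN opprB.
rewrite gradient_step_identity in h1.
rewrite /duality_gap /lyapunov /energy /= recent_travelS.
have : Lbar * (T + 1)%:R / 2 * ((T + 1)%:R * enorm (x k.+1 - x k) ^+ 2)
  = sigma * Lbar * (T + 1)%:R ^+ 2 * (enorm (x k.+1 - x k) ^+ 2 / (2 * sigma)).
  by field; rewrite gt_eqF.
move: h1 h2.
(* Inserting [x k] splits the part with the old increment into the coupling
   of the previous iteration and a product of two increments. *)
have c : - dotp (K *m (x k.+1 - u)) (2 *: y k - y k.-1)
  = dotp (K *m (x k.+1 - u)) (y k.+1 - y k)
    - dotp (K *m (x k - u)) (y k - y k.-1)
    + dotp (K *m (x k - x k.+1)) (y k - y k.-1)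
    - dotp (K *m (x k.+1 - u)) (y k.+1).
  rewrite !mulmxBr !dotpE; ring.
rewrite c !(mulmxBr K (x k.+1) u) !(dotpDr _ _ (K *m x k.+1)) !dotpNr.
rewrite !(dotpDl _ _ (y k.+1)) !dotpNl.
lra.
Qed.

(** * Boundedness and ergodic estimates *)

Lemma residual_factor_gt0 : 0 < 1 - kappa - sigma * Lbar * (T + 1)%:R ^+ 2.
Proof. by rewrite -addrA -opprD subr_gt0. Qed.

Lemma energy_ge0 u v : 0 <= @energy R d1 d2 sigma tau u v.
Proof. by rewrite addr_ge0// divr_ge0 ?sqr_ge0// mulr_ge0// ltW. Qed.

Lemma delay_term_ge0 k : 0 <= Lbar * (T + 1)%:R / 2 * recent_travel T x k.
Proof.
by rewrite mulr_ge0 ?recent_travel_ge0// divr_ge0// mulr_ge0// ltW.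
Qed.

Lemma lyapunov_ge_energy u v k :
  (1 - kappa) * energy sigma tau (x k - u) (y k - v) <= lyapunov u v k.
Proof.
have := coupling_young (K := K) (x k - u) (y k - y k.-1) sigma_gt0 tau_gt0
  kappa_ge0 kappa_ge0 (erefl : kappa * kappa = kappa ^+ 2).
have := mulr_ge0 kappa_ge0 (energy_ge0 0 (y k - v)).
have := delay_term_ge0 k; rewrite /lyapunov /energy enorm0; lra.
Qed.

Lemma lyapunov_le_energy u v k :
  lyapunov u v k <= (1 + kappa) * energy sigma tau (x k - u) (y k - v)
    + (2 * kappa * (enorm (y k - y k.-1) ^+ 2 / (2 * tau))
       + Lbar * (T + 1)%:R / 2 * recent_travel T x k).
Proof.
have := coupling_young (K := K) (- (x k - u)) (y k - y k.-1) sigma_gt0 tau_gt0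
  kappa_ge0 kappa_ge0 (erefl : kappa * kappa = kappa ^+ 2).
rewrite mulmxN dotpNl enormN.
have := mulr_ge0 kappa_ge0 (energy_ge0 0 (y k - v)).
rewrite /lyapunov /energy enorm0; lra.
Qed.

(** Adding the residual of the last dual increment restores the weight 1 on its
    square, so that Young's inequality costs only [kappa ^+ 2] on the primal
    side: this is where the constant [(1 - kappa ^+ 2)^-1] comes from. *)
Lemma lyapunov_ge_energy_sqr u v k :
  (1 - kappa ^+ 2) * energy sigma tau (x k - u) (y k - v)
  <= lyapunov u v k + (1 - kappa) * (enorm (y k - y k.-1) ^+ 2 / (2 * tau)).
Proof.
have := coupling_young (K := K) (x k - u) (y k - y k.-1) sigma_gt0 tau_gt0
  (sqr_ge0 kappa) ler01 (mulr1 _).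
have := mulr_ge0 (sqr_ge0 kappa) (energy_ge0 0 (y k - v)).
have := delay_term_ge0 k; rewrite /lyapunov /energy enorm0; lra.
Qed.

Lemma lyapunov_ge0 u v k : 0 <= lyapunov u v k.
Proof.
apply: le_trans (lyapunov_ge_energy u v k).
by rewrite mulr_ge0 ?energy_ge0// subr_ge0 ltW// kappa_lt1.
Qed.

Lemma lyapunov0 u v : lyapunov u v 0 = energy sigma tau (x 0%N - u) (y 0%N - v).
Proof.
rewrite /lyapunov recent_travel0 subrr enorm0 dotp0r.
by rewrite expr0n /= mul0r !mulr0 subr0 !addr0.
Qed.

Lemma gap_le_lyapunov u v k : hs v \is a fin_num ->
  gap (x k.+1) (y k.+1) u v <= lyapunov u v k - lyapunov u v k.+1.
Proof.
move=> hv; apply: le_trans (lyapunov_decrease u k hv).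
rewrite -addrA lerDl addr_ge0// mulr_ge0//.
- exact: ltW residual_factor_gt0.
- by rewrite divr_ge0 ?sqr_ge0// mulr_ge0// ltW.
- by rewrite subr_ge0 ltW// kappa_lt1.
- by rewrite divr_ge0 ?sqr_ge0// mulr_ge0// ltW.
Qed.

Lemma sum_gap_le u v M : hs v \is a fin_num ->
  \sum_(k < M) gap (x k.+1) (y k.+1) u v
    <= energy sigma tau (x 0%N - u) (y 0%N - v).
Proof.
move=> hv; rewrite -lyapunov0.
suff : \sum_(k < M) gap (x k.+1) (y k.+1) u v <= lyapunov u v 0 - lyapunov u v M.
  by have := lyapunov_ge0 u v M; lra.
elim: M => [|M IH]; first by rewrite big_ord0 subrr.
by rewrite big_ord_recr /=; have := gap_le_lyapunov u M hv; lra.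
Qed.

(** The gap is convex in each of its first two arguments, so Jensen's inequality
    bounds it at the averages by the mean of the gaps, and these telescope. *)
Lemma ergodic_gap_le u v M : hs v \is a fin_num ->
  hs (avg y M.+1) \is a fin_num /\
  gap (avg x M.+1) (avg y M.+1) u v
    <= M.+1%:R^-1 * energy sigma tau (x 0%N - u) (y 0%N - v).
Proof.
move=> hv.
have [_ hx] : setT (avg x M.+1) /\ F (avg x M.+1) + dotp (K *m avg x M.+1) v
    <= M.+1%:R^-1 * \sum_(k < M.+1) (F (x k.+1) + dotp (K *m x k.+1) v).
  apply: (@convex_avg _ _ setT (fun w => F w + dotp (K *m w) v)) => // t p q t01 _ _.
  split=> //; rewrite mulmxDr -!scalemxAr !dotpE.
  suff : F (t *: p + (1 - t) *: q) <= t * F p + (1 - t) * F q by lra.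
  rewrite !mulr_sumr -big_split; apply: ler_sum => i _.
  exact: convex_functionP.
have [hy hy'] : hs (avg y M.+1) \is a fin_num /\
    fine (hs (avg y M.+1)) - dotp (K *m u) (avg y M.+1)
    <= M.+1%:R^-1 * \sum_(k < M.+1) (fine (hs (y k.+1)) - dotp (K *m u) (y k.+1)).
  apply: (@convex_avg _ _ [set w | hs w \is a fin_num]
    (fun w => fine (hs w) - dotp (K *m u) w)) => [t p q t01 hp hq|k].
    have [h1 h2] := convex_efun_fine hs_proper hs_convex t01 hp hq.
    by split=> //; rewrite !dotpE; lra.
  exact: dual_iterate_fin.
split=> //; rewrite /duality_gap.
have M0 : 0 < (M.+1%:R^-1 : R) by rewrite invr_gt0.
have := ler_wpM2l (ltW M0) (sum_gap_le u M.+1 hv).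
have -> : \sum_(k < M.+1) gap (x k.+1) (y k.+1) u v =
   \sum_(k < M.+1) (F (x k.+1) + dotp (K *m x k.+1) v)
   + \sum_(k < M.+1) (fine (hs (y k.+1)) - dotp (K *m u) (y k.+1))
   + M.+1%:R * (- F u - fine (hs v)).
  have sum_cst (c : R) : \sum_(k < M.+1) c = M.+1%:R * c.
    by rewrite sumr_const card_ord mulr_natl.
  rewrite -sum_cst -!big_split /=.
  by apply: eq_bigr => k _; rewrite /duality_gap; ring.
have -> A B C : M.+1%:R^-1 * (A + B + M.+1%:R * C)
    = M.+1%:R^-1 * A + M.+1%:R^-1 * B + C :> R.
  by rewrite !mulrDr mulKf ?pnatr_eq0.
move: hx hy' => /=; move: (M.+1%:R^-1 : R) (\sum_(k < M.+1) _) => c A.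
move: (\sum_(k < M.+1) _) => B; lra.
Qed.

Lemma ergodic_pd_gap_le (M : nat) (B1 : set 'cV[R]_d1) (B2 : set 'cV[R]_d2) :
  (0 < M)%N -> B1 !=set0 -> B2 !=set0 ->
  (pd_gap Lag B1 B2 (avg x M) (avg y M)
   <= (M%:R^-1)%:E
      * ereal_sup [set (energy sigma tau (z.1 - x 0%N) (z.2 - y 0%N))%:E
                  | z in B1 `*` B2])%E.
Proof.
case: M => // M _ B10 [v0 B2v0].
have [_ [w hw]] := hs_proper.
have [hy _] := ergodic_gap_le 0 M (proper_fin hs_proper hw).
have M0 : (0 <= (M.+1%:R^-1 : R)%:E)%E by rewrite lee_fin invr_ge0.
have [u0 B1u0] := B10.
have ub u v : B1 u -> B2 v -> ((energy sigma tau (u - x 0%N) (v - y 0%N))%:E <=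
   ereal_sup [set (energy sigma tau (z.1 - x 0%N) (z.2 - y 0%N))%:E
                  | z in B1 `*` B2])%E.
  by move=> B1u B2v; apply: ereal_sup_ubound; exists (u, v).
apply: pd_gap_le => //.
  rewrite mule_ge0//; apply: le_trans (ub _ _ B1u0 B2v0).
  by rewrite lee_fin energy_ge0.
move=> u v B1u B2v hv; apply: le_trans (lee_wpmul2l M0 (ub _ _ B1u B2v)).
rewrite -EFinM lee_fin /energy -(enormN (u - _)) -(enormN (v - _)) !opprB.
by have [] := ergodic_gap_le u M hv.
Qed.

Lemma ergodic_cluster_saddle z :
  continuous F -> closed_efun hs ->
  cluster ((fun M : nat => (avg x M, avg y M)) @ \oo) z ->
  saddle_point Lag z.1 z.2.
Proof.
move=> cF hs_closed; apply: saddle_of_cluster => // [n|u v hv].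
  have [_ [w hw]] := hs_proper.
  by have [] := ergodic_gap_le 0 n (proper_fin hs_proper hw).
exists (fun n => n.+1%:R^-1 * energy sigma tau (x 0%N - u) (y 0%N - v)).
  rewrite -[X in _ --> X](mul0r (energy sigma tau (x 0%N - u) (y 0%N - v))).
  by apply: cvgMl; exact: cvg_harmonic.
by move=> n; have [] := ergodic_gap_le u n hv.
Qed.

Section Saddle.
Variables (uh : 'cV[R]_d1) (vh : 'cV[R]_d2).
Hypothesis saddle : saddle_point Lag uh vh.

Lemma increments_le k :
  (1 - kappa - sigma * Lbar * (T + 1)%:R ^+ 2)
     * (enorm (x k.+1 - x k) ^+ 2 / (2 * sigma))
  + (1 - kappa) * (enorm (y k.+1 - y k) ^+ 2 / (2 * tau))
  <= lyapunov uh vh k - lyapunov uh vh k.+1.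
Proof.
have := lyapunov_decrease uh k (saddle_dual_fin hs_proper saddle).
have := saddle_gap_ge0 hs_proper (x k.+1) saddle (dual_iterate_fin k); lra.
Qed.

Lemma primal_increment_le k :
  (1 - kappa - sigma * Lbar * (T + 1)%:R ^+ 2)
     * (enorm (x k.+1 - x k) ^+ 2 / (2 * sigma))
  <= lyapunov uh vh k - lyapunov uh vh k.+1.
Proof.
apply: le_trans (increments_le k); rewrite lerDl mulr_ge0//.
  by rewrite subr_ge0 ltW// kappa_lt1.
by rewrite divr_ge0 ?sqr_ge0// mulr_ge0// ltW.
Qed.

Lemma dual_increment_le k :
  (1 - kappa) * (enorm (y k.+1 - y k) ^+ 2 / (2 * tau))
  <= lyapunov uh vh k - lyapunov uh vh k.+1.
Proof.
apply: le_trans (increments_le k); rewrite lerDr mulr_ge0//.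
  exact: ltW residual_factor_gt0.
by rewrite divr_ge0 ?sqr_ge0// mulr_ge0// ltW.
Qed.

Lemma lyapunov_nonincreasing : nonincreasing_seq (lyapunov uh vh).
Proof.
apply/nonincreasing_seqP => k; rewrite -subr_ge0.
apply: le_trans (dual_increment_le k); rewrite mulr_ge0//.
  by rewrite subr_ge0 ltW// kappa_lt1.
by rewrite divr_ge0 ?sqr_ge0// mulr_ge0// ltW.
Qed.

Lemma energy_bound k :
  energy sigma tau (x k - uh) (y k - vh)
    <= (1 - kappa ^+ 2)^-1 * energy sigma tau (x 0%N - uh) (y 0%N - vh).
Proof.
have k2 : 0 < 1 - kappa ^+ 2.
  by rewrite subr_gt0 expr_lt1// ?kappa_ge0 ?kappa_lt1.
rewrite mulrC ler_pdivlMr// mulrC.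
case: k => [|k]; first by rewrite ler_piMl ?energy_ge0// gerBl sqr_ge0.
apply: (le_trans (lyapunov_ge_energy_sqr uh vh k.+1)).
rewrite -lyapunov0; apply: le_trans (lyapunov_nonincreasing (leq0n k)).
by have := dual_increment_le k => /=; lra.
Qed.

(** * Convergence of the iterates *)

(** The energy bound in the form that compactness and the topology of matrices
    use: bounds on the coordinates. *)
Lemma iterates_coord_bounded :
  exists2 c : R, 0 <= c & forall k,
    (forall i, `|x k i 0| <= c) /\ (forall i, `|y k i 0| <= c).
Proof.
set E := (1 - kappa ^+ 2)^-1 * energy sigma tau (x 0%N - uh) (y 0%N - vh).
have E0 : 0 <= E by apply: le_trans (energy_bound 0); exact: energy_ge0.
pose cx := enorm uh + Num.sqrt (2 * sigma * E).
pose cy := enorm vh + Num.sqrt (2 * tau * E).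
have bnd d (w w' : 'cV[R]_d) s : 0 < s -> enorm (w - w') ^+ 2 / (2 * s) <= E ->
    forall i, `|w i 0| <= enorm w' + Num.sqrt (2 * s * E).
  move=> s0 h i; have -> : w i 0 = w' i 0 + (w - w') i 0.
    by rewrite !mxE; ring.
  apply: (le_trans (ler_normD _ _)); apply: lerD; first exact: coord_le_enorm.
  apply: (le_trans (coord_le_enorm _ _)).
  rewrite -[leLHS]ger0_norm ?enorm_ge0// -sqrtr_sqr ler_wsqrtr//.
  by rewrite mulrC -ler_pdivrMr ?mulr_gt0.
have c0 d (w : 'cV[R]_d) e : 0 <= enorm w + Num.sqrt e.
  by rewrite addr_ge0 ?enorm_ge0 ?sqrtr_ge0.
exists (cx + cy) => [|k]; first by rewrite addr_ge0// c0.
have hx : 0 <= enorm (x k - uh) ^+ 2 / (2 * sigma).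
  by rewrite divr_ge0 ?sqr_ge0// mulr_ge0// ltW.
have hy : 0 <= enorm (y k - vh) ^+ 2 / (2 * tau).
  by rewrite divr_ge0 ?sqr_ge0// mulr_ge0// ltW.
have := energy_bound k; rewrite -/E {1}/energy => h; split=> i.
  have /(bnd _ _ _ _ sigma_gt0)/(_ i) : enorm (x k - uh) ^+ 2 / (2 * sigma) <= E by lra.
  by move/le_trans; apply; rewrite lerDl c0.
have /(bnd _ _ _ _ tau_gt0)/(_ i) : enorm (y k - vh) ^+ 2 / (2 * tau) <= E by lra.
by move/le_trans; apply; rewrite lerDr c0.
Qed.

Lemma iterates_cluster : cluster ((fun k => (x k, y k)) @ \oo) !=set0.
Proof.
have [c _ xy_c] := iterates_coord_bounded.
have [] := compact_setX (@compact_coord_bounded R d1 c)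
  (@compact_coord_bounded R d2 c) (F := (fun k => (x k, y k)) @ \oo).
  by exists 0%N => // k _; have [] := xy_c k.
by move=> z [_ cz]; exists z.
Qed.

Lemma lyapunov_diff_cvg0 :
  lyapunov uh vh k - lyapunov uh vh k.+1 @[k --> \oo] --> 0.
Proof.
have /cvg_ex[/= l hl] : cvgn (lyapunov uh vh).
  apply: nonincreasing_is_cvgn; first exact: lyapunov_nonincreasing.
  by exists 0 => _ [k _ <-]; exact: lyapunov_ge0.
by rewrite -(subrr l); apply: cvgB => //; rewrite cvg_shiftS.
Qed.

Lemma primal_increment_cvg0 : enorm (x k.+1 - x k) ^+ 2 @[k --> \oo] --> 0.
Proof.
apply: (cvg0_dominated (c := (1 - kappa - sigma * Lbar * (T + 1)%:R ^+ 2) / (2 * sigma))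
  _ _ _ lyapunov_diff_cvg0) => [|k|k].
- by rewrite divr_gt0 ?residual_factor_gt0// mulr_gt0.
- exact: sqr_ge0.
- by apply: le_trans (primal_increment_le k); rewrite [leLHS]mulrAC [leRHS]mulrA.
Qed.

Lemma dual_increment_cvg0 : enorm (y k.+1 - y k) ^+ 2 @[k --> \oo] --> 0.
Proof.
apply: (cvg0_dominated (c := (1 - kappa) / (2 * tau)) _ _ _ lyapunov_diff_cvg0) => [|k|k].
- by rewrite divr_gt0 ?subr_gt0 ?kappa_lt1// mulr_gt0.
- exact: sqr_ge0.
- by apply: le_trans (dual_increment_le k); rewrite [leLHS]mulrAC [leRHS]mulrA.
Qed.

(** The squared increments are summable, so [travel] converges, and
    [recent_travel] is a finite sum of differences of its terms. *)
Lemma recent_travel_cvg0 : recent_travel T x @ \oo --> 0.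
Proof.
pose c := (1 - kappa - sigma * Lbar * (T + 1)%:R ^+ 2) / (2 * sigma).
have c0 : 0 < c by rewrite divr_gt0 ?residual_factor_gt0// mulr_gt0.
have travel_le_lyap k : c * travel x k <= lyapunov uh vh 0 - lyapunov uh vh k.
  elim: k => [|k IH]; first by rewrite /travel big_ord0 mulr0 subrr.
  have := primal_increment_le k; rewrite travelS mulrDr.
  rewrite [_ * (_ / _)]mulrA [_ * _ ^+ 2 / _]mulrAC -/c; lra.
have /cvg_ex[/= l hl] : cvgn (travel x).
  apply: nondecreasing_is_cvgn; first by move=> a b; exact: travel_le.
  exists (c^-1 * lyapunov uh vh 0) => _ [k _ <-].
  rewrite -(ler_pM2l c0) mulVKf ?gt_eqF//.
  by have := travel_le_lyap k; have := lyapunov_ge0 uh vh k; lra.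
have -> : 0 = \sum_(m < T.+1) (l - l) by rewrite big1// => m _; rewrite subrr.
apply: cvg_big => [|m _]; first exact: add_continuous.
by apply: cvgB => //; rewrite (cvg_centern _ (travel x)).
Qed.

(** For an arbitrary reference point [(u, v)] monotonicity of the Lyapunov
    function is not available, but its increments still vanish: up to terms that
    do not depend on [k], it differs from the one at the saddle point by linear
    functions of the iterates and of their last increment. *)
Lemma iterates_cluster_saddle z :
  continuous F -> closed_efun hs ->
  cluster ((fun k => (x k, y k)) @ \oo) z -> saddle_point Lag z.1 z.2.
Proof.
move=> cF hs_closed; apply: saddle_of_cluster => //; first exact: dual_iterate_fin.
move=> u v hv.
exists (fun k => lyapunov u v k - lyapunov u v k.+1); last first.
  by move=> k; apply: gap_le_lyapunov.
have dotp_cvg0 d (w : 'cV[R]_d) (p : nat -> 'cV[R]_d) :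
    enorm (p k.+1 - p k) ^+ 2 @[k --> \oo] --> 0 ->
    dotp w (p k.+1 - p k) @[k --> \oo] --> 0.
  move=> h; have -> : 0 = dotp w 0 :> R by rewrite dotp0r.
  apply: (cvg_comp _ (dotp w)); last exact: continuous_dotp.
  by apply: cvg_enorm_sqr; under eq_fun do rewrite subr0.
have hx := dotp_cvg0 _ (uh - u) x primal_increment_cvg0.
have hy := dotp_cvg0 _ (vh - v) y dual_increment_cvg0.
have hyK := dotp_cvg0 _ (K *m (u - uh)) y dual_increment_cvg0.
have hyK' : dotp (K *m (u - uh)) (y k - y k.-1) @[k --> \oo] --> 0.
  by rewrite -cvg_shiftS.
have -> : (fun k => lyapunov u v k - lyapunov u v k.+1) =
    (fun k => lyapunov uh vh k - lyapunov uh vh k.+1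
      - sigma^-1 * dotp (uh - u) (x k.+1 - x k)
      - tau^-1 * dotp (vh - v) (y k.+1 - y k)
      + dotp (K *m (u - uh)) (y k - y k.-1)
      - dotp (K *m (u - uh)) (y k.+1 - y k)).
  apply/funext => k; rewrite /lyapunov /energy !enorm_sqr !mulmxBr !dotpE /=.
  rewrite !(dotpC u) !(dotpC v) !(dotpC uh) !(dotpC vh).
  by field; rewrite !gt_eqF.
rewrite (_ : 0 = 0 - sigma^-1 * 0 - tau^-1 * 0 + 0 - 0 :> R); last by ring.
apply: cvgB => //; apply: cvgD => //; apply: cvgB; last exact: cvgMr.
by apply: cvgB; [exact: lyapunov_diff_cvg0|exact: cvgMr].
Qed.

End Saddle.

(** The Lyapunov function at [(us, vs)] is nonincreasing and, up to vanishing
    terms, squeezed between multiples of the energy; the latter is arbitrarily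
    small along the iterates near the cluster point. *)
Lemma iterates_cvg_of_cluster us vs :
  saddle_point Lag us vs -> cluster ((fun k => (x k, y k)) @ \oo) (us, vs) ->
  x @ \oo --> us /\ y @ \oo --> vs.
Proof.
move=> S clS.
have k1 : 0 < 1 - kappa by rewrite subr_gt0 kappa_lt1.
pose r k : R := 2 * kappa * (enorm (y k - y k.-1) ^+ 2 / (2 * tau))
  + Lbar * (T + 1)%:R / 2 * recent_travel T x k.
have r0 : r @ \oo --> 0.
  have -> : 0 = 2 * kappa * (0 / (2 * tau)) + Lbar * (T + 1)%:R / 2 * 0 :> R.
    by rewrite mul0r !mulr0 addr0.
  apply: cvgD; apply: cvgMr; last exact: recent_travel_cvg0 S.
  apply: cvgMl; rewrite -cvg_shiftS; exact: dual_increment_cvg0 S.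
have e_cvg0 : energy sigma tau (x k - us) (y k - vs) @[k --> \oo] --> 0.
  apply/cvgr0Pnorm_le => e e0.
  (* Three times [d] bounds the Lyapunov function, since [1 + kappa <= 2]. *)
  pose d : R := (1 - kappa) * e / 3.
  have d0 : 0 < d by rewrite divr_gt0// mulr_gt0.
  have /cvgr0_norm_le /(_ _ d0) [n0 _ rn0] := r0.
  have [n n0n en] : exists2 n, (n0 <= n)%N & energy sigma tau (x n - us) (y n - vs) < d.
    pose B := [set w : 'cV[R]_d1 * 'cV[R]_d2 |
      energy sigma tau (w.1 - us) (w.2 - vs) < d].
    have B_nbhs : nbhs (us, vs) B.
      have ce := @continuous_energy R d1 d2 sigma tau us vs (us, vs).
      apply: (cvgr_lt _ ce); rewrite /= /energy !subrr !enorm0 expr0n /= !mul0r.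
      by rewrite addr0.
    have tail : ((fun k => (x k, y k)) @ \oo)
        ((fun k => (x k, y k)) @` [set n | (n0 <= n)%N]).
      by exists n0 => // k n0k; exists k.
    by have [_ [[n n0n <-] Bn]] := clS _ _ tail B_nbhs; exists n.
  exists n => // M nM; rewrite ger0_norm ?energy_ge0//.
  rewrite -(ler_pM2l k1).
  apply: (le_trans (lyapunov_ge_energy us vs M)).
  apply: (le_trans (lyapunov_nonincreasing S nM)).
  apply: (le_trans (lyapunov_le_energy us vs n)); rewrite -/(r n).
  have := rn0 n n0n; rewrite ler_norml => /andP[_ rn].
  have : (1 + kappa) * energy sigma tau (x n - us) (y n - vs) <= 2 * d.
    apply: ler_pM; rewrite ?energy_ge0 ?(ltW en)//.
      by rewrite addr_ge0 ?kappa_ge0.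
    by have := kappa_lt1; lra.
  by have : d = (1 - kappa) * e / 3 by []; lra.
have half2 (s : R) : 0 < s -> 0 < (2 * s)^-1 by move=> s0; rewrite invr_gt0 mulr_gt0.
split; apply: cvg_enorm_sqr.
  apply: (cvg0_dominated (half2 _ sigma_gt0) _ _ e_cvg0) => k; first exact: sqr_ge0.
  by rewrite mulrC lerDl divr_ge0 ?sqr_ge0// mulr_ge0// ltW.
apply: (cvg0_dominated (half2 _ tau_gt0) _ _ e_cvg0) => k; first exact: sqr_ge0.
by rewrite mulrC lerDr divr_ge0 ?sqr_ge0// mulr_ge0// ltW.
Qed.

End Iteration.

(** * The convergence theorem *)

Theorem theorem3p1 (R : realType) (d1 d2 N : nat)
  (f : 'I_N -> 'cV[R]_d1 -> R) (L : 'I_N -> R)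
  (K : 'M[R]_(d2, d1)) (hs : 'cV[R]_d2 -> \bar R)
  (T : nat) (delay : nat -> 'I_N -> nat) (sigma tau : R)
  (x : nat -> 'cV[R]_d1) (y : nat -> 'cV[R]_d2)
  (xh : 'cV[R]_d1) (yh : 'cV[R]_d2)
  (Lag := lagrangian (fun u => \sum_(i < N) f i u) K hs)
  (f_diff : forall i u, differentiable (f i) u)
  (f_convex : forall i, convex_function [set: convex_lmodType 'cV[R]_d1] (f i))
  (f_smooth : forall i, Lsmooth (L i) (f i))
  (L_gt0 : 0 < \sum_(i < N) L i)
  (hs_proper : proper_efun hs) (hs_closed : closed_efun hs) (hs_convex : convex_efun hs)
  (delay_le : forall k i, (delay k i <= T)%N)
  (saddle : saddle_point Lag xh yh)
  (sigma_gt0 : 0 < sigma) (tau_gt0 : 0 < tau)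
  (step : Num.sqrt (tau * sigma) * opnorm K
          + sigma * (\sum_(i < N) L i) * (T + 1)%:R ^+ 2 < 1)
  (iter : pd_piag f K hs sigma tau delay x y) :
  (bounded_set (range (fun k => (x k, y k))) /\
   forall k : nat,
     enorm (x k - xh) ^+ 2 / (2 * sigma) + enorm (y k - yh) ^+ 2 / (2 * tau)
     <= (1 - tau * sigma * opnorm K ^+ 2)^-1
        * (enorm (x 0%N - xh) ^+ 2 / (2 * sigma)
           + enorm (y 0%N - yh) ^+ 2 / (2 * tau)))
  /\
  ((forall (M : nat) (B1 : set 'cV[R]_d1) (B2 : set 'cV[R]_d2),
      (0 < M)%N -> B1 !=set0 -> B2 !=set0 ->
      bounded_set B1 -> closed B1 -> bounded_set B2 -> closed B2 ->
      (pd_gap Lag B1 B2 (avg x M) (avg y M)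
       <= (M%:R^-1)%:E
          * ereal_sup [set (enorm (z.1 - x 0%N) ^+ 2 / (2 * sigma)
                            + enorm (z.2 - y 0%N) ^+ 2 / (2 * tau))%:E
                      | z in B1 `*` B2])%E) /\
   (forall z : 'cV[R]_d1 * 'cV[R]_d2,
      cluster ((fun M : nat => (avg x M, avg y M)) @ \oo) z ->
      saddle_point Lag z.1 z.2))
  /\
  (exists (xs : 'cV[R]_d1) (ys : 'cV[R]_d2),
     [/\ saddle_point Lag xs ys, x @ \oo --> xs & y @ \oo --> ys]).
Proof.
have F_cont : continuous (fun u => \sum_(i < N) f i u).
  by apply: continuous_sum => i u; apply/differentiable_continuous/f_diff.
have k2 : tau * sigma * opnorm K ^+ 2 = (Num.sqrt (tau * sigma) * opnorm K) ^+ 2.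
  by rewrite exprMn sqr_sqrtr// mulr_ge0// ltW.
split; first split.
- have [c c0 xy_c] := iterates_coord_bounded f_convex f_smooth L_gt0 hs_proper
    hs_convex delay_le sigma_gt0 tau_gt0 step iter saddle.
  exists c; split=> [|b cb]; first exact: num_real.
  move=> _ [k _ <-]; have [xc yc] := xy_c k.
  apply: le_trans (ltW cb); rewrite prod_normE ge_max /=.
  by apply/andP; split; apply: norm_le_of_coord => // i j; rewrite ord1.
- by move=> k; rewrite k2; apply: (energy_bound f_convex f_smooth L_gt0 hs_proper
    hs_convex delay_le sigma_gt0 tau_gt0 step iter saddle k).
split; first split.
- by move=> M B1 B2 M0 B10 B20 _ _ _ _; apply: (ergodic_pd_gap_le f_convex f_smooth L_gt0 hs_proper
    hs_convex delay_le sigma_gt0 tau_gt0 step iter).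
- by move=> z; apply: (ergodic_cluster_saddle f_convex f_smooth L_gt0 hs_proper
    hs_convex delay_le sigma_gt0 tau_gt0 step iter).
have [[xs ys] cl] : cluster ((fun k => (x k, y k)) @ \oo) !=set0.
  exact: (iterates_cluster f_convex f_smooth L_gt0 hs_proper
    hs_convex delay_le sigma_gt0 tau_gt0 step iter saddle).
have S : saddle_point Lag xs ys.
  exact: (iterates_cluster_saddle f_convex f_smooth L_gt0 hs_proper
    hs_convex delay_le sigma_gt0 tau_gt0 step iter saddle F_cont hs_closed cl).
exists xs, ys.
by have [] := iterates_cvg_of_cluster f_convex f_smooth L_gt0 hs_proper
    hs_convex delay_le sigma_gt0 tau_gt0 step iter S cl.
Qed.
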